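(* Let $G$ be a Coxeter group with (at least two) Coxeter generators, among which are two generators $r_1$ and $r_2$ such that their product $r_1r_2$ has finite order $m\geq 3$ in $G$. Then there exists no injective group homomorphism $\mu: G\to \mathcal{R}(\mathbb{C})$ from $G$ into the Riordan group over $\mathbb{C}$.
   Context: Coxeter group: a group with a presentation $G\cong\langle r_1,\ldots,r_k \mid (r_ir_j)^{m_{ij}}=1\rangle$, where $m_{ii}=1$ and, for $i\neq j$, $m_{ij}=m_{ji}\geq 2$ is an integer or $\infty$ ($m_{ij}=\infty$ means that no relation between $r_i$ and $r_j$ is imposed). The elements $r_1,\ldots,r_k$ are the Coxeter generators. Riordan group: for a field $\mathbb{K}$, $\mathcal{R}(\mathbb{K})$ is the set of pairs $(g(t),f(t))$ of formal power series in $\mathbb{K}[[t]]$ with $g(0)\neq 0$, $f(0)=0$ and $f'(0)\neq 0$, with group operation $(g_1(t),f_1(t))*(g_2(t),f_2(t))=(g_1(t)\,g_2(f_1(t)),\,f_2(f_1(t)))$ and identity $(1,t)$. The pair $(g,f)$ is identified with the infinite lower triangular matrix with entries $a_{n,k}=[t^n]\,g(t)f(t)^k$, $n,k\geq 0$, and the operation corresponds to matrix multiplication. *)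

(* Defs.v *)
From HB Require Import structures.
From mathcomp Require Import all_boot all_order all_fingroup all_algebra.
From mathcomp Require Import boolp reals complex.
From mathcomp Require Import zify.

Set Implicit Arguments.
Unset Strict Implicit.
Unset Printing Implicit Defensive.

Import GRing.Theory.
Local Open Scope ring_scope.

Reserved Notation "f \oS g" (at level 50).

(* A series coerces to its coefficient function: [f n] is [t^n] f(t).  The
   record prevents [fps K] from inheriting the pointwise ring structure of
   functions. *)
Record fps (K : Type) : Type := Fps { fps_coef :> nat -> K }.

Lemma fpsP (K : Type) (f g : fps K) : (forall n, f n = g n) <-> f = g.
Proof.
by split=> [|-> //]; case: f g => f [g] /= fg; congr Fps; apply: funext.
Qed.

HB.instance Definition _ (K : Type) := Choice.copy (fps K) {classic fps K}.

Section PolyCongruence.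
Variable K : fieldType.
Implicit Types (p q : {poly K}) (f g : fps K).

(* Congruence modulo X^N; ring identities on series are transported from
   polynomials through it. *)
Definition poly_eqmod N p q := forall i, (i < N)%N -> p`_i = q`_i.

Lemma poly_eqmod_trans N p q r :
  poly_eqmod N p q -> poly_eqmod N q r -> poly_eqmod N p r.
Proof. by move=> pq qr i iN; rewrite pq ?qr. Qed.

Lemma poly_eqmod_sym N p q : poly_eqmod N p q -> poly_eqmod N q p.
Proof. by move=> pq i iN; rewrite pq. Qed.

Lemma poly_eqmodM N p p' q q' : poly_eqmod N p p' -> poly_eqmod N q q' ->
  poly_eqmod N (p * q) (p' * q').
Proof.
move=> pp qq i iN; rewrite !coefM; apply: eq_bigr => j _.
by rewrite pp ?qq //; apply: leq_ltn_trans iN; rewrite ?leq_subr // -ltnS.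
Qed.

Lemma poly_eqmodX N p q k :
  poly_eqmod N p q -> poly_eqmod N (p ^+ k) (q ^+ k).
Proof.
by move=> pq; elim: k => [|k IH] //; rewrite !exprS; apply: poly_eqmodM.
Qed.

Lemma coefX_lt p k i : p`_0 = 0 -> (i < k)%N -> (p ^+ k)`_i = 0.
Proof.
move=> p0; elim: k i => [//|k IH] i ik; rewrite exprS coefM big1 // => -[j /=].
case: j => [|j] ji _; first by rewrite p0 mul0r.
by rewrite IH ?mulr0 //; lia.
Qed.

Lemma coef_comp_lt p q N i : q`_0 = 0 -> (i < N)%N ->
  (p \Po q)`_i = \sum_(k < N) p`_k * (q ^+ k)`_i.
Proof.
move=> q0 iN; pose M := maxn N (size p).
have widen n : (forall k, (n <= k)%N -> p`_k * (q ^+ k)`_i = 0) ->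
    (n <= M)%N ->
    \sum_(k < n) p`_k * (q ^+ k)`_i = \sum_(k < M) p`_k * (q ^+ k)`_i.
  move=> z nM; rewrite (big_ord_widen M (fun k => p`_k * (q ^+ k)`_i) nM).
  rewrite big_mkcond; apply: eq_bigr => k _; case: ltnP => // /z -> //.
rewrite coef_comp_poly widen ?leq_maxr => [|k pk|//]; last first.
  by rewrite nth_default ?mul0r.
symmetry; apply: widen => [k Nk|]; last exact: leq_maxl.
by rewrite coefX_lt ?mulr0 //; apply: leq_trans Nk.
Qed.

Lemma poly_eqmod_comp N p p' q q' : q`_0 = 0 -> q'`_0 = 0 ->
  poly_eqmod N p p' -> poly_eqmod N q q' ->
  poly_eqmod N (p \Po q) (p' \Po q').
Proof.
move=> q0 q'0 pp qq i iN; rewrite !(@coef_comp_lt _ _ N) //.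
by apply: eq_bigr => k _; rewrite pp // (poly_eqmodX k qq).
Qed.

Definition fps_trunc N f : {poly K} := \poly_(i < N) f i.

Lemma coef_trunc N f i : (i < N)%N -> (fps_trunc N f)`_i = f i.
Proof. by move=> iN; rewrite coef_poly iN. Qed.

Lemma fps_truncP f g :
  (forall N, poly_eqmod N (fps_trunc N f) (fps_trunc N g)) -> f = g.
Proof.
move=> fg; apply/fpsP => n; have := fg n.+1 n (ltnSn n).
by rewrite !coef_trunc.
Qed.

End PolyCongruence.

Section FpsRing.
Variable K : fieldType.
Implicit Types f g h : fps K.

Definition fps_zero : fps K := Fps (fun=> 0).
Definition fps_opp f : fps K := Fps (fun n => - f n).
Definition fps_add f g : fps K := Fps (fun n => f n + g n).
Definition fps_one : fps K := Fps (fun n => (n == 0%N)%:R).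
Definition fps_mul f g : fps K :=
  Fps (fun n => \sum_(i < n.+1) f i * g (n - i)%N).

Fact fps_addA : associative fps_add.
Proof. by move=> f g h; apply/fpsP => n /=; rewrite addrA. Qed.
Fact fps_addC : commutative fps_add.
Proof. by move=> f g; apply/fpsP => n /=; rewrite addrC. Qed.
Fact fps_add0 : left_id fps_zero fps_add.
Proof. by move=> f; apply/fpsP => n /=; rewrite add0r. Qed.
Fact fps_addN : left_inverse fps_zero fps_opp fps_add.
Proof. by move=> f; apply/fpsP => n /=; rewrite addNr. Qed.

HB.instance Definition _ :=
  GRing.isZmodule.Build (fps K) fps_addA fps_addC fps_add0 fps_addN.

Lemma trunc_mul N f g :
  poly_eqmod N (fps_trunc N (fps_mul f g)) (fps_trunc N f * fps_trunc N g).
Proof.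
move=> i iN; rewrite coef_trunc // coefM; apply: eq_bigr => -[j /= ji] _.
by rewrite !coef_trunc //; lia.
Qed.

Fact fps_mulA : associative fps_mul.
Proof.
move=> f g h; apply: fps_truncP => N.
apply: poly_eqmod_trans (trunc_mul _ _) _.
apply: poly_eqmod_trans (poly_eqmodM (fun _ _ => erefl) (trunc_mul _ _)) _.
rewrite mulrA; apply: poly_eqmod_sym.
apply: poly_eqmod_trans (trunc_mul _ _) _.
exact: poly_eqmodM (trunc_mul _ _) (fun _ _ => erefl).
Qed.
Fact fps_mulC : commutative fps_mul.
Proof.
move=> f g; apply: fps_truncP => N.
apply: poly_eqmod_trans (trunc_mul _ _) _.
by rewrite mulrC; apply: poly_eqmod_sym; apply: trunc_mul.
Qed.
Fact fps_mul1 : left_id fps_one fps_mul.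
Proof.
move=> f; apply/fpsP => n /=; rewrite big_ord_recl /= mul1r subn0 big1 ?addr0 //.
by move=> i _; rewrite mul0r.
Qed.
Fact fps_mulDl : left_distributive fps_mul fps_add.
Proof.
move=> f g h; apply/fpsP => n /=; rewrite -big_split /=.
by apply: eq_bigr => i _; rewrite mulrDl.
Qed.
Fact fps_one_neq0 : fps_one != 0.
Proof. by apply/eqP => /fpsP /(_ 0%N) /= /eqP; rewrite oner_eq0. Qed.

HB.instance Definition _ := GRing.Zmodule_isComNzRing.Build (fps K)
  fps_mulA fps_mulC fps_mul1 fps_mulDl fps_one_neq0.

Lemma fps_coefM f g n : (f * g) n = \sum_(i < n.+1) f i * g (n - i)%N.
Proof. by []. Qed.

Definition fps_X : fps K := Fps (fun n => (n == 1%N)%:R).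

Definition fps_deriv f : fps K := Fps (fun n => f n.+1 *+ n.+1).

(* [g \oS f] is g(f(t)), meaningful when f(0) = 0: then f^k contributes
   nothing to the coefficient of t^n for k > n, so the sum of g_k f^k can be
   cut at k = n. *)
Definition fps_comp g f : fps K :=
  Fps (fun n => \sum_(k < n.+1) g k * (f ^+ k) n).
Local Notation "g \oS f" := (fps_comp g f) : ring_scope.

Lemma trunc_exp N f k :
  poly_eqmod N (fps_trunc N (f ^+ k)) (fps_trunc N f ^+ k).
Proof.
elim: k => [|k IH]; first by move=> i iN; rewrite coef_trunc // coef1.
rewrite !exprS; apply: poly_eqmod_trans (trunc_mul _ _) _.
exact: poly_eqmodM.
Qed.

Lemma trunc0 N f : f 0%N = 0 -> (fps_trunc N f)`_0 = 0.
Proof. by move=> f0; rewrite coef_poly f0 if_same. Qed.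

Lemma fps_expX_lt f k n : f 0%N = 0 -> (n < k)%N -> (f ^+ k) n = 0.
Proof.
move=> f0 nk; rewrite -(coef_trunc _ (ltnSn n)) trunc_exp //.
by rewrite coefX_lt // trunc0.
Qed.

Lemma fps_comp_widen g f n N : f 0%N = 0 -> (n < N)%N ->
  (g \oS f) n = \sum_(k < N) g k * (f ^+ k) n.
Proof.
move=> f0 nN; rewrite /= (big_ord_widen N (fun k => g k * (f ^+ k) n) nN).
rewrite big_mkcond; apply: eq_bigr => k _; case: ltnP => // nk.
by rewrite fps_expX_lt ?mulr0.
Qed.

Lemma trunc_comp N g f : f 0%N = 0 ->
  poly_eqmod N (fps_trunc N (g \oS f)) (fps_trunc N g \Po fps_trunc N f).
Proof.
move=> f0 i iN; rewrite coef_trunc // (fps_comp_widen _ f0 iN).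
rewrite (coef_comp_lt _ _ iN) ?trunc0 //; apply: eq_bigr => k _.
by rewrite coef_trunc // -(trunc_exp _ _ iN) coef_trunc.
Qed.

Lemma fps_comp0 g f : (g \oS f) 0%N = g 0%N.
Proof. by rewrite /= big_ord1 expr0 mulr1. Qed.

Lemma fps_comp_coef1 g f : (g \oS f) 1%N = g 1%N * f 1%N.
Proof. by rewrite /= big_ord_recl big_ord1 expr0 expr1 /= mulr0 add0r. Qed.

Lemma fps_compM a b f : f 0%N = 0 -> (a * b) \oS f = (a \oS f) * (b \oS f).
Proof.
move=> f0; apply: fps_truncP => N.
apply: poly_eqmod_trans (trunc_comp _ f0) _.
apply: poly_eqmod_trans
  (poly_eqmod_comp (trunc0 _ f0) (trunc0 _ f0) (trunc_mul _ _)
     (fun _ _ => erefl)) _.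
rewrite comp_polyM; apply: poly_eqmod_sym.
apply: poly_eqmod_trans (trunc_mul _ _) _.
by apply: poly_eqmodM; apply: trunc_comp.
Qed.

Lemma fps_comp1 f : 1 \oS f = 1.
Proof.
apply/fpsP => n /=; rewrite big_ord_recl /= mul1r big1 ?addr0 //.
by move=> i _; rewrite mul0r.
Qed.

Lemma fps_compX a f k : f 0%N = 0 -> (a ^+ k) \oS f = (a \oS f) ^+ k.
Proof.
move=> f0; elim: k => [|k IH]; first by rewrite !expr0 fps_comp1.
by rewrite !exprS fps_compM // IH.
Qed.

Lemma fps_compA a f h : f 0%N = 0 -> h 0%N = 0 ->
  a \oS (f \oS h) = (a \oS f) \oS h.
Proof.
move=> f0 h0; have fh0 : (f \oS h) 0%N = 0 by rewrite fps_comp0.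
apply: fps_truncP => N; apply: poly_eqmod_trans (trunc_comp _ fh0) _.
apply: poly_eqmod_trans (poly_eqmod_comp (trunc0 _ fh0) _
  (fun _ _ => erefl) (trunc_comp _ h0)) _.
  by rewrite (@coef_comp_lt _ _ _ 1) ?trunc0 // big_ord1 trunc0 ?mul0r.
rewrite comp_polyA; apply: poly_eqmod_sym.
apply: poly_eqmod_trans (trunc_comp _ h0) _.
by apply: poly_eqmod_comp; rewrite ?trunc0 //; apply: trunc_comp.
Qed.

Lemma fps_coefXn k n : (fps_X ^+ k) n = (n == k)%:R.
Proof.
elim: k n => [|k IH] n //; rewrite exprS fps_coefM.
case: n => [|n]; first by rewrite big_ord1 /= mul0r.
rewrite big_ord_recl /= mul0r add0r big_ord_recl /= mul1r IH subSS subn0.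
by rewrite big1 ?addr0 // => i _; rewrite mul0r.
Qed.

Lemma fps_comp_X g : g \oS fps_X = g.
Proof.
apply/fpsP => n /=; rewrite big_ord_recr /= fps_coefXn eqxx mulr1 big1 ?add0r //.
by move=> -[i /= ilt] _; rewrite fps_coefXn gtn_eqF ?mulr0.
Qed.

Lemma fps_X_comp f : f 0%N = 0 -> fps_X \oS f = f.
Proof.
move=> f0; apply/fpsP => -[|n] /=; first by rewrite big_ord1 mul0r f0.
rewrite big_ord_recl /= mul0r add0r big_ord_recl /= mul1r expr1 big1 ?addr0 //.
by move=> i _; rewrite mul0r.
Qed.

Lemma fps_mul_comp_coef g a f n : f 0%N = 0 ->
  (g * (a \oS f)) n = \sum_(j < n.+1) (g * f ^+ j) n * a j.
Proof.
move=> f0; rewrite fps_coefM.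
under eq_bigr => i _ do
  rewrite (@fps_comp_widen _ _ _ n.+1 f0) ?ltnS ?leq_subr // mulr_sumr.
rewrite exchange_big; apply: eq_bigr => j _ /=.
by rewrite mulr_suml; apply: eq_bigr => i _; rewrite mulrCA mulrC.
Qed.

Lemma fps_mulX_lt g f k n : f 0%N = 0 -> (n < k)%N -> (g * f ^+ k) n = 0.
Proof.
move=> f0 nk; rewrite fps_coefM big1 // => i _.
by rewrite fps_expX_lt ?mulr0 //; lia.
Qed.

Lemma fps_mulX_diag g f n :
  f 0%N = 0 -> (g * f ^+ n) n = g 0%N * f 1%N ^+ n.
Proof.
move=> f0.
have powE m : (f ^+ m) m = f 1%N ^+ m.
  elim: m => [//|m IH]; rewrite exprS fps_coefM.
  rewrite big_ord_recl f0 mul0r add0r big_ord_recl /= subSS subn0 IH big1.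
    by rewrite addr0 exprS.
  by move=> i _; rewrite fps_expX_lt ?mulr0 //= /bump /=; have := ltn_ord i; lia.
rewrite fps_coefM big_ord_recl subn0 powE big1 ?addr0 // => i _.
by rewrite fps_expX_lt ?mulr0 //= /bump /=; have := ltn_ord i; lia.
Qed.

End FpsRing.

Notation "g \oS f" := (fps_comp g f) : ring_scope.

Section TriangularSolve.
Variables (K : fieldType) (a : nat -> nat -> K) (b : nat -> K).

Fixpoint trsolve_seq n : seq K :=
  if n is n'.+1 then
    let s := trsolve_seq n' in
    rcons s ((b n' - \sum_(k < n') a n' k * s`_k) / a n' n')
  else [::].

(* Forward substitution for the lower triangular system a x = b. *)
Definition trsolve : fps K := Fps (fun n => (trsolve_seq n.+1)`_n).

Lemma size_trsolve n : size (trsolve_seq n) = n.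
Proof. by elim: n => //= n IH; rewrite size_rcons IH. Qed.

Lemma nth_trsolve n k : (k < n)%N -> (trsolve_seq n)`_k = trsolve k.
Proof.
elim: n => // n IH; rewrite ltnS leq_eqVlt => /orP[/eqP-> //|kn].
by rewrite /= nth_rcons size_trsolve kn IH.
Qed.

Lemma trsolveP n : a n n != 0 -> \sum_(k < n.+1) a n k * trsolve k = b n.
Proof.
move=> ann; rewrite big_ord_recr /= nth_rcons size_trsolve ltnn eqxx.
under [X in _ - X]eq_bigr => k _ do rewrite nth_trsolve //.
by rewrite mulrC divfK // addrC subrK.
Qed.

End TriangularSolve.

Definition riordan_pred (K : fieldType) : pred (fps K * fps K) :=
  fun gf => [&& gf.1 0%N != 0, gf.2 0%N == 0 & fps_deriv gf.2 0%N != 0].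

Record riordan (K : fieldType) : Type := Riordan {
  riordan_pair :> fps K * fps K;
  riordan_pairP : riordan_pred riordan_pair }.

HB.instance Definition _ (K : fieldType) :=
  [isSub for @riordan_pair K].
HB.instance Definition _ (K : fieldType) := [Choice of riordan K by <:].

Section RiordanGroup.
Variable K : fieldType.
Implicit Types x y z : riordan K.

Lemma riordan_g0 x : x.1 0%N != 0.
Proof. by case/and3P: (riordan_pairP x). Qed.
Lemma riordan_f0 x : x.2 0%N = 0.
Proof. by case/and3P: (riordan_pairP x) => _ /eqP. Qed.
Lemma riordan_f1 x : x.2 1%N != 0.
Proof. by case/and3P: (riordan_pairP x). Qed.

Lemma riordan_predI (g f : fps K) :
  g 0%N != 0 -> f 0%N = 0 -> f 1%N != 0 -> riordan_pred (g, f).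
Proof. by move=> g0 /eqP f0 f1; apply/and3P. Qed.

Fact riordan_one_subproof : riordan_pred (1, fps_X K).
Proof. by apply: riordan_predI; rewrite //= ?oner_eq0. Qed.
Definition riordan_one := Riordan riordan_one_subproof.

Fact riordan_mul_subproof x y :
  riordan_pred (x.1 * (y.1 \oS x.2), y.2 \oS x.2).
Proof.
apply: riordan_predI.
- by rewrite fps_coefM big_ord1 fps_comp0 mulf_neq0 ?riordan_g0.
- by rewrite fps_comp0 riordan_f0.
- by rewrite fps_comp_coef1 mulf_neq0 ?riordan_f1.
Qed.
Definition riordan_mul x y := Riordan (riordan_mul_subproof x y).

(* The inverse solves (g, f) * (u, v) = (1, t), which is triangular in the
   coefficients of u and of v. *)
Definition riordan_inv_pair x : fps K * fps K :=
  (trsolve (fun n k => (x.1 * x.2 ^+ k) n) (1 : fps K),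
   trsolve (fun n k => (1 * x.2 ^+ k) n) (fps_X K)).

Lemma riordan_inv_pairE x :
  x.1 * ((riordan_inv_pair x).1 \oS x.2) = 1 /\
  (riordan_inv_pair x).2 \oS x.2 = fps_X K.
Proof.
have f0 := riordan_f0 x; have f1 := riordan_f1 x; have g0 := riordan_g0 x.
split; last rewrite -[LHS]mul1r; apply/fpsP => n;
  rewrite fps_mul_comp_coef // trsolveP // fps_mulX_diag //.
  by rewrite mulf_neq0 ?expf_neq0.
by rewrite mulf_neq0 ?expf_neq0 //= oner_eq0.
Qed.

Fact riordan_inv_subproof x : riordan_pred (riordan_inv_pair x).
Proof.
have [/fpsP Eg /fpsP Ef] := riordan_inv_pairE x.
rewrite [riordan_inv_pair x]surjective_pairing; apply: riordan_predI.
- apply/eqP => g0; move: (Eg 0%N).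
  rewrite fps_coefM big_ord1 fps_comp0 g0 mulr0 => /esym/eqP.
  by rewrite oner_eq0.
- by have := Ef 0%N; rewrite fps_comp0.
- apply/eqP => f1; move: (Ef 1%N).
  by rewrite fps_comp_coef1 f1 mul0r => /esym/eqP; rewrite oner_eq0.
Qed.
Definition riordan_inv x := Riordan (riordan_inv_subproof x).

Fact riordan_mulA : associative riordan_mul.
Proof.
move=> x y z; apply: val_inj => /=.
by rewrite fps_compM ?riordan_f0 // mulrA !fps_compA ?riordan_f0.
Qed.
Fact riordan_mul1 : left_id riordan_one riordan_mul.
Proof.
move=> x; apply: val_inj => /=.
by rewrite !fps_comp_X mul1r -surjective_pairing.
Qed.
Fact riordan_mulr1 : right_id riordan_one riordan_mul.
Proof.
move=> x; apply: val_inj => /=.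
by rewrite fps_comp1 fps_X_comp ?riordan_f0 // mulr1 -surjective_pairing.
Qed.
Fact riordan_mulrV : right_inverse riordan_one riordan_inv riordan_mul.
Proof.
by move=> x; apply: val_inj => /=; case: (riordan_inv_pairE x) => -> ->.
Qed.
Fact riordan_mulV : left_inverse riordan_one riordan_inv riordan_mul.
Proof.
move=> x; set y := riordan_inv x.
rewrite -[LHS]riordan_mulr1 -(riordan_mulrV y) -riordan_mulA (riordan_mulA x).
by rewrite (riordan_mulrV x) riordan_mul1.
Qed.

HB.instance Definition _ := isGroup.Build (riordan K)
  riordan_mulA riordan_mul1 riordan_mulr1 riordan_mulV riordan_mulrV.

Definition riordan_mx x (n k : nat) : K := (x.1 * x.2 ^+ k) n.

Lemma riordan_mxM x y n k :
  riordan_mx (x * y)%g n k =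
  \sum_(j < n.+1) riordan_mx x n j * riordan_mx y j k.
Proof.
have f0 := riordan_f0 x.
have -> : riordan_mx (x * y)%g n k =
  (x.1 * (y.1 \oS x.2) * (y.2 \oS x.2) ^+ k) n by [].
by rewrite -fps_compX // -mulrA -fps_compM // fps_mul_comp_coef.
Qed.

Lemma riordan_mx_trig x n k : (n < k)%N -> riordan_mx x n k = 0.
Proof. by move=> nk; apply: fps_mulX_lt nk; apply: riordan_f0. Qed.

End RiordanGroup.

Local Open Scope group_scope.

Section Presentation.
Variable I : Type.

(* The letter (i, b) stands for the generator i if b = false and for its
   formal inverse if b = true. *)
Definition gword := seq (I * bool).

(* [gword_eq rel] is the congruence on words whose quotient is the group
   presented by the generators I and the relations w = 1 for w in [rel]. *)
Inductive gword_eq (rel : gword -> Prop) : gword -> gword -> Prop :=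
| gword_eq_refl w : gword_eq rel w w
| gword_eq_sym u v : gword_eq rel u v -> gword_eq rel v u
| gword_eq_trans u v w :
    gword_eq rel u v -> gword_eq rel v w -> gword_eq rel u w
| gword_eq_cat u u' v v' :
    gword_eq rel u u' -> gword_eq rel v v' -> gword_eq rel (u ++ v) (u' ++ v')
| gword_eq_cancel i b : gword_eq rel [:: (i, b); (i, ~~ b)] [::]
| gword_eq_rel w : rel w -> gword_eq rel w [::].

Definition gword_eval (G : groupType) (r : I -> G) (w : gword) : G :=
  \prod_(l <- w) (if l.2 then (r l.1)^-1 else r l.1).

(* Evaluation induces an isomorphism from the group presented by I and [rel]
   onto G. *)
Definition presented_by (G : groupType) (r : I -> G) (rel : gword -> Prop) :=
  (forall x : G, exists w, gword_eval r w = x) /\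
  (forall u v, gword_eval r u = gword_eval r v <-> gword_eq rel u v).

End Presentation.

(* [None] stands for infinity. *)
Definition coxeter_matrix (k : nat) (m : 'I_k -> 'I_k -> option nat) : Prop :=
  [/\ forall i, m i i = Some 1%N,
      forall i j, m i j = m j i
    & forall i j, i != j -> if m i j is Some n then (2 <= n)%N else true].

Inductive coxeter_relator (k : nat) (m : 'I_k -> 'I_k -> option nat) :
    gword 'I_k -> Prop :=
| CoxeterRelator i j n : m i j = Some n ->
    coxeter_relator m (flatten (nseq n [:: (i, false); (j, false)])).

Definition coxeter_presentation (G : groupType) (k : nat)
    (m : 'I_k -> 'I_k -> option nat) (r : 'I_k -> G) : Prop :=
  coxeter_matrix m /\ presented_by r (coxeter_relator m).

Definition has_order (G : groupType) (x : G) (m : nat) : Prop :=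
  [/\ (0 < m)%N, x ^+ m = 1 & forall l, (0 < l < m)%N -> x ^+ l <> 1].

(* Main.v *)
(* The diagonal of a lower triangular matrix is multiplicative, so for two
   involutions x and y the element (x y)^2 is unipotent.  In characteristic 0 a
   unipotent lower triangular matrix of finite order is the identity: its first
   nonzero subdiagonal is multiplied by N when passing to the N-th power. *)
Require Import Defs.
From mathcomp Require Import all_boot all_order all_fingroup all_algebra.
From mathcomp Require Import reals complex.
From mathcomp Require Import zify.

Set Implicit Arguments.
Unset Strict Implicit.
Unset Printing Implicit Defensive.

Import GRing.Theory Num.Theory.
Local Open Scope ring_scope.

Section RiordanTorsion.
Variable K : fieldType.
Implicit Types x y : riordan K.

Lemma riordan_mx1 n k : riordan_mx (1%g : riordan K) n k = (n == k)%:R.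
Proof. by rewrite -[LHS]/((1 * fps_X K ^+ k) n) mul1r fps_coefXn. Qed.

(** Columns 0 and 1 of the matrix are $g$ and $g f$, so they already determine the pair. *)
Lemma riordan_mx_eq1 x :
  (forall n k, riordan_mx x n k = (n == k)%:R) -> x = 1%g.
Proof.
move=> xE; have x1 : x.1 = 1.
  by apply/fpsP => n; have := xE n 0%N; rewrite /riordan_mx expr0 mulr1.
have x2 : x.2 = fps_X K.
  by apply/fpsP => n; have := xE n 1%N; rewrite /riordan_mx x1 mul1r expr1.
by apply: val_inj; rewrite /= [riordan_pair x]surjective_pairing x1 x2.
Qed.

Lemma riordan_mx_diagM x y n :
  riordan_mx (x * y)%g n n = riordan_mx x n n * riordan_mx y n n.
Proof.
rewrite riordan_mxM big_ord_recr /= big1 ?add0r // => i _.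
by rewrite (riordan_mx_trig y) ?mulr0.
Qed.

(** For $d > 0$: ones on the diagonal and zeros on subdiagonals $1, \ldots, d-1$. Depth 1 is
    unipotency; depth 0 holds for every [x]. *)
Definition delta_below d x :=
  forall n k, (n < k + d)%N -> riordan_mx x n k = (n == k)%:R.

(** In the sum over $j$, terms with $j < k$ vanish because [y] is triangular, and those with $k < j
    < k+d$ because [x] is zero there; $j = k$ and $j = k+d$ give the two summands. *)
Lemma delta_below_subdiagM d x y k : (0 < d)%N ->
    delta_below d x -> delta_below d y ->
  riordan_mx (x * y)%g (k + d) k =
  riordan_mx x (k + d) k + riordan_mx y (k + d) k.
Proof.
move=> d0 xd yd; have kd : (k < (k + d).+1)%N by lia.
rewrite riordan_mxM (bigD1 (Ordinal kd)) //= yd ?eqxx ?mulr1; last by lia.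
congr (_ + _); rewrite (bigD1 ord_max) /=; last by rewrite -val_eqE /=; lia.
rewrite xd ?eqxx ?mul1r; last by lia.
rewrite big1 ?addr0 // => j /andP[]; rewrite -!val_eqE /= => jk jkd.
case: (ltnP j k) => [jltk|kj]; first by rewrite (riordan_mx_trig y) ?mulr0.
by rewrite xd; [rewrite eq_sym (negPf jkd) mul0r | lia].
Qed.

Lemma delta_belowM d x y :
  delta_below d x -> delta_below d y -> delta_below d (x * y)%g.
Proof.
move=> xd yd n k nkd; case: (ltnP n k) => [nk|kn].
  by rewrite riordan_mx_trig // ltn_eqF.
case: (eqVneq n k) => [<-|nk].
  by rewrite riordan_mx_diagM xd ?yd ?eqxx ?mulr1 //; lia.
(* Additivity applies at the smaller depth $n - k$, where both summands vanish since $0 < n - k <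
   d$. *)
have nE : n = (k + (n - k))%N by lia.
rewrite [in LHS]nE delta_below_subdiagM; first last.
- by move=> i j ij; apply: yd; lia.
- by move=> i j ij; apply: xd; lia.
- by lia.
by rewrite -nE xd ?yd // (negPf nk) addr0.
Qed.

Lemma delta_belowX d x N : delta_below d x -> delta_below d (x ^+ N)%g.
Proof.
move=> xd; elim: N => [|N IH]; first by move=> n k _; rewrite expg0 riordan_mx1.
by rewrite expgS; apply: delta_belowM.
Qed.

Lemma delta_below_subdiagX d x N k : (0 < d)%N -> delta_below d x ->
  riordan_mx (x ^+ N)%g (k + d) k = riordan_mx x (k + d) k *+ N.
Proof.
move=> d0 xd; elim: N => [|N IH].
  by rewrite expg0 riordan_mx1 mulr0n (_ : (_ == _) = false) //; lia.
by rewrite expgS delta_below_subdiagM ?IH ?mulrS //; apply: delta_belowX.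
Qed.

Lemma riordan_unipotent_torsion_free x N : [pchar K] =i pred0 ->
    (forall n, riordan_mx x n n = 1) ->
  (0 < N)%N -> (x ^+ N)%g = 1%g -> x = 1%g.
Proof.
move=> char0 diag1 N0 xN1.
(* Subdiagonals are cleared one at a time by induction, starting from depth 1, which is the
   unipotency of [x]. *)
suff xd d : delta_below d.+1 x.
  by apply: riordan_mx_eq1 => n k; apply: (xd n); lia.
elim: d => [|d IH] n k nkd.
  case: (ltngtP n k) nkd => [nk|nk|->] nkd; last exact: diag1.
    by rewrite riordan_mx_trig.
  by lia.
case: (ltnP n (k + d.+1)) => [|knd]; first exact: IH.
have {knd nkd} -> : n = (k + d.+1)%N by lia.
have := delta_below_subdiagX N k (ltn0Sn d) IH.
rewrite xN1 riordan_mx1 (_ : (_ == _) = false); last by lia.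
(* The entry times $N$ is zero, and $N$ is nonzero in characteristic 0. *)
move=> /esym/eqP; rewrite -[_ *+ N]mulr_natr mulf_eq0 ((pcharf0P _).1 char0).
by rewrite eqn0Ngt N0 orbF => /eqP.
Qed.

Lemma riordan_involutions_sqr x y N : [pchar K] =i pred0 ->
    (x * x)%g = 1%g -> (y * y)%g = 1%g ->
  (0 < N)%N -> ((x * y) ^+ N)%g = 1%g -> ((x * y) ^+ 2)%g = 1%g.
Proof.
move=> char0 xx yy N0 xyN.
apply: (riordan_unipotent_torsion_free char0 _ N0); last first.
  by rewrite -expgM mulnC expgM xyN expg1n.
(* Diagonal entries commute in [K], so the diagonal of $(xy)^2$ is that of $x^2 y^2$. *)
move=> n; rewrite expgS expg1 !riordan_mx_diagM mulrACA -!riordan_mx_diagM.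
by rewrite xx yy mulg1 riordan_mx1 eqxx.
Qed.

End RiordanTorsion.

(** Since $m_{ii} = 1$, the relator for the pair $(i, i)$ is the two-letter word $r_i r_i$. *)
Lemma coxeter_generator_sqr (G : groupType) k (M : 'I_k -> 'I_k -> option nat)
    (r : 'I_k -> G) i :
  coxeter_presentation M r -> (r i * r i)%g = 1%g.
Proof.
case=> -[Mii _ _] [_ rel].
have /rel := gword_eq_rel (CoxeterRelator (Mii i)).
by rewrite /gword_eval /= !big_cons !big_nil /= mulg1.
Qed.

Lemma multiplicative1 (G H : groupType) (f : {multiplicative G -> H}) :
  f 1%g = 1%g.
Proof. by apply: (mulgI (f 1%g)); rewrite -gmulfM !mulg1. Qed.

Lemma multiplicativeX (G H : groupType) (f : {multiplicative G -> H}) n :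
  {morph f : x / (x ^+ n)%g}.
Proof.
move=> x; elim: n => [|n IH]; first by rewrite !expg0 multiplicative1.
by rewrite !expgS gmulfM IH.
Qed.

Theorem theorem3 (R : realType) (G : groupType) (k : nat)
    (M : 'I_k -> 'I_k -> option nat) (r : 'I_k -> G)
    (hk : (2 <= k)%N) (hG : coxeter_presentation M r)
    (i1 i2 : 'I_k) (hi : i1 != i2) (m : nat) (hm : (3 <= m)%N)
    (hord : has_order (r i1 * r i2)%g m) :
  ~ exists mu : {multiplicative G -> riordan R[i]}, injective mu.
Proof.
case=> mu mu_inj; case: hord => m0 rm minm.
(* As $2 < m$, a trivial square of $r_1 r_2$ contradicts the minimality of $m$; injectivity lets
   triviality be checked on the image. *)
apply: (minm 2%N); first by rewrite /= hm.
apply: mu_inj; rewrite multiplicativeX multiplicative1 gmulfM.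
apply: (@riordan_involutions_sqr _ _ _ m) => //; first exact: pchar_num.
- by rewrite -gmulfM (coxeter_generator_sqr _ hG) multiplicative1.
- by rewrite -gmulfM (coxeter_generator_sqr _ hG) multiplicative1.
- by rewrite -gmulfM -multiplicativeX rm multiplicative1.
Qed.
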